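(* Define Knuth's up-arrow operations on positive integers by $a\uparrow^1 b=a^b$, $a\uparrow^k 1=a$ and $a\uparrow^{k}(b+1)=a\uparrow^{k-1}(a\uparrow^{k}b)$ for $k\ge2$, $b\ge1$. Let $g_1=3\uparrow^4 3$ and $g_{i}=3\uparrow^{g_{i-1}}3$ for $i\ge2$. Then the sequence $(g_i)_{i\ge1}$ converges in the ring $\mathbb{Z}_{10}$ of $10$-adic integers, the sequence $(3\uparrow\uparrow j)_{j\ge1}$ (where $3\uparrow\uparrow j=3\uparrow^2 j$) also converges in $\mathbb{Z}_{10}$, and the two limits coincide: $\lim_{i\to\infty}g_i=\lim_{j\to\infty}3\uparrow\uparrow j$ in $\mathbb{Z}_{10}$.
   Context: $\mathbb{Z}_{10}=\varprojlim_m\mathbb{Z}/10^m\mathbb{Z}$ is the ring of $10$-adic integers; a sequence of integers converges in $\mathbb{Z}_{10}$ iff for every $m$ its last $m$ decimal digits are eventually constant. Graham's number is $G=g_{64}$. *)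

(* Defs.v *)
From mathcomp Require Import all_boot.
Set Implicit Arguments. Unset Strict Implicit. Unset Printing Implicit Defensive.

(* up k a b = a ↑^(k+1) b  (for b >= 1):
   up 0 a b = a ^ b,  up (k+1) a 1 = a,  up (k+1) a (b+1) = up k a (up (k+1) a b). *)
Fixpoint up (k a b : nat) : nat :=
  match k with
  | 0 => a ^ b
  | k'.+1 => iter b.-1 (up k' a) a
  end.

Definition uparrow (k a b : nat) : nat := up k.-1 a b.

(* Graham's sequence: g 1 = 3 ↑^4 3, g (i+1) = 3 ↑^(g i) 3; g 0 is a dummy value. *)
Fixpoint g (i : nat) : nat :=
  match i with
  | 0 => 0
  | i'.+1 => match i' with
             | 0 => uparrow 4 3 3
             | _ => uparrow (g i') 3 3
             end
  end.

Definition tet3 (j : nat) : nat := uparrow 2 3 j.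

(* Convergence in Z_10: for every m the last m decimal digits are eventually constant. *)
Definition converges10 (u : nat -> nat) : Prop :=
  forall m : nat, exists N : nat, forall n : nat, N <= n -> u n = u N %[mod 10 ^ m].

(* Two convergent sequences have the same 10-adic limit iff for every m their
   eventual residues mod 10^m agree. *)
Definition same_limit10 (u v : nat -> nat) : Prop :=
  forall m : nat, exists N : nat, forall i j : nat, N <= i -> N <= j ->
    u i = v j %[mod 10 ^ m].

(* Main.v *)
(** Lifting [3 ^ 20 = 1 (mod 200)] by [x = 1 (mod M), p | M -> x ^ p = 1
    (mod p M)] gives [3 ^ (10 ^ k) = 1 (mod 10 ^ (k + 1))] for [k >= 2], so
    exponents agreeing modulo [10 ^ k] give powers of 3 agreeing modulo
    [10 ^ (k + 1)]; with the residues of [3 ↑↑ j] modulo 4, 20 and 100 this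
    shows by induction that [3 ↑↑ j] is constant modulo [10 ^ m] once
    [j >= m + 3].  Every higher arrow with base 3 unfolds into a tower of 3s,
    so each [g_i] equals some [3 ↑↑ n] with [n > i], and [g] inherits the
    eventual residues of the tower. *)

Require Import Defs.
From mathcomp Require Import all_boot.

Lemma expn_mod_lift p M x :
  0 < x -> p %| M -> x = 1 %[mod M] -> x ^ p = 1 %[mod p * M].
Proof.
move=> x_gt0 pM xM; apply/eqP; rewrite eqn_mod_dvd ?expn_gt0 ?x_gt0 //.
rewrite -(exp1n p) subn_exp [_ * \sum_(i < p) _]mulnC dvdn_mul //; last first.
  by rewrite -eqn_mod_dvd ?exp1n // xM.
have sumM : \sum_(i < p) x ^ (p.-1 - i) * 1 ^ i = p %[mod M].
  rewrite -modn_summ (eq_bigr (fun=> 1 %% M)) => [|i _].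
    by rewrite modn_summ sum1_card card_ord.
  by rewrite exp1n muln1 -modnXm xM modnXm exp1n.
by rewrite /dvdn -(modn_dvdm _ pM) sumM modn_dvdm // modnn.
Qed.

Lemma eq_mod_dvd [d m x y : nat] : d %| m -> x = y %[mod m] -> x = y %[mod d].
Proof. by move=> dm xy; rewrite -(modn_dvdm x dm) xy modn_dvdm. Qed.

Lemma expn_congr_mod [a d M x y : nat] :
  a ^ d = 1 %[mod M] -> x = y %[mod d] -> a ^ x = a ^ y %[mod M].
Proof.
move=> adM xy.
have expn_modd z : a ^ z = a ^ (z %% d) %[mod M].
  rewrite {1}(divn_eq z d) expnD (mulnC _ d) expnM -modnMml -modnXm adM.
  by rewrite modnXm exp1n modnMml mul1n.
by rewrite expn_modd xy -expn_modd.
Qed.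

Lemma pow3_mod200 : 3 ^ 20 = 1 %[mod 200].
Proof. by rewrite (expnM 3 5 4) -modnXm (_ : 3 ^ 5 %% 200 = 43). Qed.

Lemma pow3_period k : 3 ^ 10 ^ k.+2 = 1 %[mod 10 ^ k.+3].
Proof.
elim: k => [|k IHk].
  by rewrite (expnM 3 20 5) -[10 ^ 3]/(5 * 200) expn_mod_lift ?expn_gt0 ?pow3_mod200.
by rewrite expnSr expnM (expnS _ k.+3) expn_mod_lift ?expn_gt0 ?dvdn_exp.
Qed.

Lemma tet3S j : tet3 j.+2 = 3 ^ tet3 j.+1.
Proof. by []. Qed.

Lemma tet3_mod4 j : tet3 j.+1 = 3 %[mod 4].
Proof.
elim: j => [|j IHj] //; rewrite tet3S (@expn_congr_mod 3 2 4 _ 1) //.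
exact: eq_mod_dvd (isT : 2 %| 4) IHj.
Qed.

Lemma tet3_mod20 j : tet3 j.+2 = 7 %[mod 20].
Proof. by rewrite tet3S (@expn_congr_mod 3 4 20 _ 3) // tet3_mod4. Qed.

Lemma tet3_mod100 j : tet3 j.+3 = 87 %[mod 100].
Proof.
have pow3_mod100 := eq_mod_dvd (isT : 100 %| 200) pow3_mod200.
by rewrite tet3S (expn_congr_mod pow3_mod100 (tet3_mod20 j)).
Qed.

Lemma tet3_step n j : n.+3 <= j -> tet3 j.+1 = tet3 j %[mod 10 ^ n.+2].
Proof.
elim: n j => [|n IHn] j j_ge;
  have [k jE] : exists k, j = k.+3 by exists (j - 3); rewrite -addn3 subnK ?(leq_trans _ j_ge).
  by rewrite jE (tet3_mod100 k.+1) (tet3_mod100 k).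
by subst j; exact: expn_congr_mod (pow3_period n) (IHn k.+2 j_ge).
Qed.

Lemma congr_mod_stable (u : nat -> nat) d N :
  (forall j, N <= j -> u j.+1 = u j %[mod d]) ->
  forall j, N <= j -> u j = u N %[mod d].
Proof.
move=> uS j /subnKC <-; elim: (j - N) => [|i IHi]; first by rewrite addn0.
by rewrite addnS uS ?leq_addr.
Qed.

Lemma tet3_stable [m j : nat] : m.+3 <= j -> tet3 j = tet3 m.+3 %[mod 10 ^ m].
Proof.
move=> j_ge; apply: (eq_mod_dvd (dvdn_exp2l 10 (leqW (leqnSn m)))).
by apply: congr_mod_stable j_ge => i; apply: tet3_step.
Qed.

Lemma ltn_up k [a] b : 1 < a -> b < up k a b.
Proof.
elim: k b => [|k IHk] b a_gt1; first exact: ltn_expl.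
have iter_ge n : n + a <= iter n (up k a) a.
  by elim: n => [|n IHn] //=; apply: leq_ltn_trans (IHk _ a_gt1).
apply: leq_trans (iter_ge _); case: b => [|b] /=; first exact: ltnW.
by rewrite -addn2 leq_add2l.
Qed.

Lemma up_tower k a b :
  1 < a -> 0 < b -> exists2 n, b <= n & up k.+1 a b = up 1 a n.
Proof.
move=> a_gt1; elim: k b => [|k IHk] b b_gt0; first by exists b.
case: b b_gt0 => [|[|b]] // _; first by exists 1.
have [n n_ge upn] := IHk (up k.+2 a b.+1) (leq_ltn_trans (leq0n _) (ltn_up _ _ a_gt1)).
exists n; last exact: upn.
exact: leq_trans (ltn_up _ _ a_gt1) n_ge.
Qed.

Lemma ltn_up33 k : k.+2 < up k 3 3.
Proof.
elim: k => [|k IHk] //.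
by rewrite (_ : up k.+1 3 3 = up k 3 (up k 3 3)) // (leq_ltn_trans IHk (ltn_up _ _ _)).
Qed.

Lemma ltn_tet3 n : n < tet3 n.
Proof. exact: ltn_up. Qed.

Lemma gSS i : g i.+2 = uparrow (g i.+1) 3 3.
Proof. by []. Qed.

Lemma g_tet3 i : exists2 n, i.+2 <= n & g i.+1 = tet3 n.
Proof.
elim: i => [|i [n n_ge gn]].
  by have [n n_ge gn] := up_tower 2 3 3 isT isT; exists n; [apply: ltnW | apply: gn].
have tetn_gt : i.+2 < tet3 n := leq_ltn_trans n_ge (ltn_tet3 n).
have [k tetn] : exists k, tet3 n = k.+3.
  by exists (tet3 n - 3); rewrite -addn3 subnK // (leq_trans _ tetn_gt).
have [m m_ge upm] := up_tower k 3 (up k.+1 3 3) isT (leq_ltn_trans (leq0n _) (ltn_up33 _)).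
exists m; last by rewrite gSS gn /uparrow tetn; apply: upm.
apply: leq_trans m_ge; apply: leq_trans (ltnW (ltn_up33 k.+1)).
by rewrite -tetn.
Qed.

Lemma g_stable [m i : nat] : m.+3 <= i -> g i = tet3 m.+3 %[mod 10 ^ m].
Proof.
case: i => [|i] // i_ge; have [n n_ge ->] := g_tet3 i.
by apply: tet3_stable; apply: leq_trans i_ge (ltnW n_ge).
Qed.

Theorem mainTheorem5 : converges10 g /\ converges10 tet3 /\ same_limit10 g tet3.
Proof.
split; [|split] => m; exists m.+3.
- by move=> i i_ge; rewrite (g_stable i_ge) (g_stable (leqnn _)).
- exact: tet3_stable.
- by move=> i j i_ge j_ge; rewrite (g_stable i_ge) (tet3_stable j_ge).
Qed.
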